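(* Let $A$ be an $n\times n$ Bott matrix with exactly $k$ non-zero rows, where $k$ is an even number. For $1\le i<j\le n$ let $A_{ij}$ be the $n\times n$ matrix whose $i$-th and $j$-th rows are equal to the $i$-th and $j$-th rows of $A$ and all of whose other rows are zero. Then the real Bott manifold $M(A)$ has a Spin-structure if and only if for all $1\le i<j\le n$ the real Bott manifold $M(A_{ij})$ has a Spin-structure.
   Context: A binary matrix has entries in $\{0,1\}=\mathbb{Z}_2$. A binary $n\times n$ matrix $A$ is a Bott matrix if $A=PBP^{-1}$ for some permutation matrix $P$ and some strictly upper triangular binary matrix $B$. For an $n\times n$ Bott matrix $A=[a_{ij}]$, the real Bott manifold $M(A)$ is the flat manifold $\mathbb{R}^n/\Gamma(A)$, where $\Gamma(A)\subset \operatorname{Isom}(\mathbb{R}^n)=O(n)\ltimes\mathbb{R}^n$ is the group generated by $s_1,\dots,s_n$, with $s_i=(\operatorname{diag}((-1)^{a_{i1}},\dots,(-1)^{a_{in}}),\ \tfrac12 e_i)$ and $e_i$ the $i$-th standard basis vector. (Here $a_{ii}=0$.) Each $A_{ij}$ is again a Bott matrix, so $M(A_{ij})$ is defined in the same way. An oriented flat manifold $\mathbb{R}^n/\Gamma$, with $\Gamma\subset SO(n)\ltimes\mathbb{R}^n$ its fundamental group and $p$ the projection to $SO(n)$, has a Spin-structure if and only if there is a homomorphism $\epsilon:\Gamma\to\operatorname{Spin}(n)$ with $\lambda_n\epsilon=p$, where $\lambda_n:\operatorname{Spin}(n)\to SO(n)$ is the covering map; equivalently, its second Stiefel–Whitney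 class $w_2$ vanishes. ''Has a Spin-structure'' includes being orientable. $M(A)$ is orientable if and only if the sum of the entries in each row of $A$ is even. *)

(* Defs.v *)
From HB Require Import structures.
From mathcomp Require Import all_boot all_order all_fingroup all_algebra.
From mathcomp Require Import reals ring zify.

Set Implicit Arguments.
Unset Strict Implicit.
Unset Printing Implicit Defensive.
Import GRing.Theory Num.Theory.
Local Open Scope ring_scope.

(* The Clifford algebra Cl_n of -(x_1^2 + ... + x_n^2), in its basis e_S, the
   products in increasing order of the e_i, i in S, where e_i e_i = -1 and
   e_i e_j = - e_j e_i for i != j.  An element is the family of its coordinates;
   e_S e_T = cl_sign S T * e_(symdiff S T). *)

Definition symdiff (I : finType) (S T : {set I}) : {set I} :=
  [set i | (i \in S) (+) (i \in T)].

(* One sign for each pair i > j put back in order, and one for each square. *)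
Definition cl_sign (R : pzRingType) (n : nat) (S T : {set 'I_n}) : R :=
  (-1) ^+ #|[set p : 'I_n * 'I_n | [&& p.1 \in S, p.2 \in T & (p.2 <= p.1)%N]]|.

Section SymDiff.
Variable I : finType.
Implicit Types S T U : {set I}.

Lemma symdiffC S T : symdiff S T = symdiff T S.
Proof. by apply/setP => i; rewrite !inE addbC. Qed.

Lemma symdiffA S T U : symdiff S (symdiff T U) = symdiff (symdiff S T) U.
Proof. by apply/setP => i; rewrite !inE addbA. Qed.

Lemma symdiff0s S : symdiff set0 S = S.
Proof. by apply/setP => i; rewrite !inE. Qed.

Lemma symdiffss S : symdiff S S = set0.
Proof. by apply/setP => i; rewrite !inE addbb. Qed.

Lemma symdiffK S : involutive (symdiff S).
Proof. by move=> T; rewrite symdiffA symdiffss symdiff0s. Qed.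

Lemma symdiff_eq0 S T : (symdiff S T == set0) = (S == T).
Proof.
by rewrite -(inj_eq (inv_inj (symdiffK S))) symdiffK symdiffC symdiff0s eq_sym.
Qed.
End SymDiff.

Section SignTheory.
Variables (R : comPzRingType) (n : nat).
Implicit Types S T U : {set 'I_n}.
Local Notation sg := (cl_sign R).

Lemma cl_signE S T : sg S T =
  \prod_(p : 'I_n * 'I_n) (-1) ^+ [&& p.1 \in S, p.2 \in T & (p.2 <= p.1)%N].
Proof.
rewrite prodrXr /cl_sign; congr (_ ^+ _).
by rewrite -sum1_card big_mkcond; apply: eq_bigr => p _; rewrite inE; case: ifP.
Qed.

Lemma cl_sign_symdiffl S T U : sg (symdiff S T) U = sg S U * sg T U.
Proof.
rewrite !cl_signE -big_split; apply: eq_bigr => p _ /=.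
by rewrite -signr_addb inE -andb_addl.
Qed.

Lemma cl_sign_symdiffr S T U : sg S (symdiff T U) = sg S T * sg S U.
Proof.
rewrite !cl_signE -big_split; apply: eq_bigr => p _ /=.
by rewrite -signr_addb inE -andb_addr -andb_addl.
Qed.

Lemma cl_sign0s S : sg set0 S = 1.
Proof. by rewrite cl_signE big1 // => p _; rewrite inE. Qed.

Lemma cl_signs0 S : sg S set0 = 1.
Proof. by rewrite cl_signE big1 // => p _; rewrite inE andbF. Qed.

Lemma sign_symdiff S T :
  (-1) ^+ #|symdiff S T| = (-1) ^+ #|S| * (-1) ^+ #|T| :> R.
Proof.
have signE U : (-1) ^+ #|U| = \prod_i (-1) ^+ (i \in U) :> R.
  by rewrite prodrXr -sum1_card big_mkcond.
rewrite !signE -big_split; apply: eq_bigr => i _ /=.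
by rewrite -signr_addb inE.
Qed.

Lemma cl_sign_diag S : sg S S = (-1) ^+ (#|S| + 'C(#|S|, 2)).
Proof.
rewrite /cl_sign; congr (_ ^+ _).
set P := [set p | _].
pose P' := [set p : 'I_n * 'I_n | [&& p.1 \in S, p.2 \in S & (p.2 < p.1)%N]].
pose D := [set (i, i) | i in S].
have cD : #|D| = #|S| by rewrite card_imset // => i j [].
have PE : P = D :|: P'.
  apply/setP => -[i j]; rewrite !inE /= leq_eqVlt.
  have -> : ((i, j) \in D) = (i \in S) && (j == i).
    by apply/imsetP/andP => [[k kS [-> ->]]//|[iS /eqP->]]; exists i.
  rewrite -[(j == i :> nat)]/(j == i).
  by have [->|_] := eqVneq j i; rewrite /= ?ltnn; case: (i \in S).
have DP' : [disjoint D & P'].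
  apply/pred0P => -[i j] /=; apply/negP => /andP[/imsetP[k _ [-> ->]]].
  by rewrite inE /= ltnn !andbF.
have cP : #|P| = (#|S| + #|P'|)%N.
  by rewrite PE cardsU disjoint_setI0 // cards0 subn0 cD.
rewrite cP; congr (_ + _)%N.
have : (#|P| + #|P'| = #|S| * #|S|)%N.
  rewrite -cardsX -(cardsID P (setX S S)); congr (_ + _)%N.
    apply: eq_card => -[i j]; rewrite !inE /=.
    by case: (i \in S); case: (j \in S).
  pose sw (p : 'I_n * 'I_n) := (p.2, p.1).
  have swK : involutive sw by case.
  rewrite -(card_imset _ (inv_inj swK)); apply: eq_card => -[i j].
  rewrite -[(i, j)]swK mem_imset ?inE /=; last exact: inv_inj.
  by rewrite ltnNge; case: (i \in S); case: (j \in S) => //=; rewrite andbT.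
move=> E; have {E} : (#|S| + #|P'| + #|P'| = #|S| * #|S|)%N.
  by rewrite -cP.
rewrite bin2; move: #|S| #|P'| => s c E.
have : (c.*2 = s * s.-1)%N by case: s E => [|s] /=; lia.
by move=> <-; rewrite doubleK.
Qed.
End SignTheory.

Definition clifford (R : comNzRingType) (n : nat) : Type :=
  {ffun {set 'I_n} -> R^o}.

HB.instance Definition _ (R : comNzRingType) (n : nat) :=
  GRing.Lmodule.copy (clifford R n) {ffun {set 'I_n} -> R^o}.

Section CliffordAlgebra.
Variables (R : comNzRingType) (n : nat).
Local Notation Cl := (clifford R n).
Implicit Types (x y z : Cl) (S T U : {set 'I_n}).

Definition cl_basis S : Cl := [ffun U => (U == S)%:R].

Definition cl_one : Cl := cl_basis set0.

Definition cl_mul x y : Cl :=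
  [ffun U => \sum_S cl_sign R S (symdiff S U) * x S * y (symdiff S U)].

Fact cl_mulA : associative cl_mul.
Proof.
move=> x y z; apply/ffunP => U; rewrite !ffunE.
transitivity (\sum_S \sum_T cl_sign R S (symdiff S U)
    * cl_sign R T (symdiff T (symdiff S U))
    * x S * y T * z (symdiff T (symdiff S U))).
  apply: eq_bigr => S _; rewrite ffunE mulr_sumr; apply: eq_bigr => T _.
  by rewrite !mulrA -!(mulrAC _ (x S)).
under [RHS]eq_bigr => V _ do rewrite ffunE mulr_sumr mulr_suml.
rewrite [RHS]exchange_big; apply: eq_bigr => S _ /=.
rewrite [RHS](reindex_inj (inv_inj (symdiffK S))); apply: eq_bigr => T _ /=.
rewrite symdiffK -(symdiffA S T U) (symdiffC S (symdiff T U)).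
rewrite -symdiffA (symdiffC U S).
set W := symdiff T (symdiff S U).
have -> : symdiff S U = symdiff T W by rewrite /W symdiffK.
rewrite cl_sign_symdiffl cl_sign_symdiffr !mulrA.
by congr (_ * _ * _ * _); rewrite -mulrA mulrC.
Qed.

Fact cl_mul1 : left_id cl_one cl_mul.
Proof.
move=> x; apply/ffunP => U; rewrite ffunE (bigD1 set0) //= ffunE eqxx.
rewrite symdiff0s cl_sign0s !mul1r big1 ?addr0 // => S /negPf S0.
by rewrite ffunE S0 mulr0 mul0r.
Qed.

Fact cl_mulr1 : right_id cl_one cl_mul.
Proof.
move=> x; apply/ffunP => U; rewrite ffunE (bigD1 U) //= ffunE symdiffss eqxx.
rewrite cl_signs0 mul1r mulr1 big1 ?addr0 // => S /negPf SU.
by rewrite ffunE symdiff_eq0 SU mulr0.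
Qed.

Fact cl_mulDl : left_distributive cl_mul +%R.
Proof.
move=> x y z; apply/ffunP => U; rewrite !ffunE -big_split.
by apply: eq_bigr => S _; rewrite ffunE /= mulrDr mulrDl.
Qed.

Fact cl_mulDr : right_distributive cl_mul +%R.
Proof.
move=> x y z; apply/ffunP => U; rewrite !ffunE -big_split.
by apply: eq_bigr => S _; rewrite ffunE /= mulrDr.
Qed.

Fact cl_one_neq0 : cl_one != 0.
Proof.
apply/eqP => /ffunP/(_ set0); rewrite !ffunE eqxx => /eqP.
by rewrite oner_eq0.
Qed.

HB.instance Definition _ := GRing.Zmodule_isNzRing.Build Cl
  cl_mulA cl_mul1 cl_mulr1 cl_mulDl cl_mulDr cl_one_neq0.

Fact cl_scaleAl (a : R) x y : a *: (x * y) = (a *: x) * y.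
Proof.
apply/ffunP => U; rewrite !ffunE scaler_sumr; apply: eq_bigr => S _.
by rewrite ffunE /= -[a *: _]/(a * _) -[a *: x S]/(a * _) !mulrA (mulrC a).
Qed.

Fact cl_scaleAr (a : R) x y : a *: (x * y) = x * (a *: y).
Proof.
apply/ffunP => U; rewrite !ffunE scaler_sumr; apply: eq_bigr => S _.
rewrite ffunE /= -[a *: _]/(a * _) -[a *: y _]/(a * _).
by rewrite mulrCA !mulrA.
Qed.

HB.instance Definition _ :=
  GRing.Lmodule_isLalgebra.Build R Cl cl_scaleAl.
HB.instance Definition _ :=
  GRing.Lalgebra_isAlgebra.Build R Cl cl_scaleAr.

(* The inclusion of R^n in Cl_n. *)
Definition cl_vec (v : 'cV[R]_n) : Cl :=
  \sum_(i < n) v i 0 *: cl_basis [set i].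

(* The anti-automorphism x |-> x^* fixing R^n; reversing the product of #|S|
   generators takes 'C(#|S|, 2) transpositions. *)
Definition cl_rev x : Cl := 
  [ffun S : {set 'I_n} => (-1) ^+ 'C(#|S|, 2) * x S].

Lemma cl_mulE x y U :
  (x * y) U = \sum_S cl_sign R S (symdiff S U) * x S * y (symdiff S U).
Proof. by rewrite ffunE. Qed.

Lemma cl_basisM S T :
  cl_basis S * cl_basis T = cl_sign R S T *: cl_basis (symdiff S T).
Proof.
apply/ffunP => U; rewrite cl_mulE (bigD1 S) //= big1 ?addr0; last first.
  by move=> V /negPf VS; rewrite ffunE VS mulr0 mul0r.
rewrite !ffunE eqxx mulr1 -[RHS]/(_ * _).
rewrite -[U in RHS](symdiffK S) (inj_eq (inv_inj (symdiffK S))).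
by have [->|_] := eqVneq (symdiff S U) T; rewrite ?mulr0.
Qed.

Lemma cl_basis_sqr i : cl_basis [set i] * cl_basis [set i] = -1.
Proof.
rewrite cl_basisM symdiffss /cl_sign -scaleN1r; congr (_ *: _).
rewrite (_ : [set _ | _] = [set (i, i)]) ?cards1 //.
apply/setP => -[a b]; rewrite !inE xpair_eqE /=.
by have [->|] := eqVneq a i; have [->|] := eqVneq b i; rewrite ?leqnn.
Qed.

Lemma cl_basis_anticomm i j : i != j ->
  cl_basis [set i] * cl_basis [set j] = - (cl_basis [set j] * cl_basis [set i]).
Proof.
move=> ij; rewrite !cl_basisM (symdiffC [set j]) -scaleNr; congr (_ *: _).
have sgE (a b : 'I_n) : cl_sign R [set a] [set b] = (-1) ^+ (b <= a)%N.
  rewrite cl_signE (bigD1 (a, b)) //= !inE !eqxx big1 ?mulr1 // => -[c d].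
  by rewrite xpair_eqE !inE /= andbA; case: (_ && _).
rewrite !sgE leqNgt ltn_neqAle (_ : (i != j :> nat) = true) //=.
by case: (i <= j)%N; rewrite ?opprK.
Qed.

Lemma cl_vec_anticomm (u v : 'cV[R]_n) :
  cl_vec u * cl_vec v + cl_vec v * cl_vec u
    = - (\sum_i u i 0 * v i 0) *+ 2 *: 1.
Proof.
have vecM (a b : 'cV[R]_n) : cl_vec a * cl_vec b =
    \sum_i \sum_j (a i 0 * b j 0) *: (cl_basis [set i] * cl_basis [set j]).
  rewrite mulr_suml; apply: eq_bigr => i _; rewrite mulr_sumr.
  by apply: eq_bigr => j _; rewrite -scalerAl -scalerAr scalerA.
rewrite (vecM u) vecM [X in _ + X]exchange_big -big_split /=.
rewrite -sumrN -sumrMnl scaler_suml.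
apply: eq_bigr => i _; rewrite -big_split (bigD1 i) //= big1 ?addr0.
  rewrite cl_basis_sqr (mulrC (v i 0)) -scalerDl -mulr2n scalerN.
  by rewrite -scaleNr mulNrn.
move=> j ji; rewrite (cl_basis_anticomm ji) (mulrC (v j 0)) scalerN.
exact: subrr.
Qed.

Fact cl_rev_is_linear : linear cl_rev.
Proof.
move=> a x y; apply/ffunP => S; rewrite !ffunE mulrDr.
congr (_ + _); rewrite -[a *: _]/(a * _) -[a *: (_ * _)]/(a * (_ * _)).
by rewrite mulrCA.
Qed.
HB.instance Definition _ :=
  GRing.isLinear.Build R Cl Cl *:%R cl_rev cl_rev_is_linear.

Lemma cl_sumE x : x = \sum_S x S *: cl_basis S.
Proof.
apply/ffunP => U; rewrite sum_ffunE (bigD1 U) //= big1 ?addr0.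
  by rewrite !ffunE eqxx -[RHS]/(_ * _) mulr1.
by move=> S SU; rewrite !ffunE eq_sym (negPf SU) scaler0.
Qed.

Lemma cl_rev_basis S : cl_rev (cl_basis S) = (-1) ^+ 'C(#|S|, 2) *: cl_basis S.
Proof.
apply/ffunP => U; rewrite !ffunE -[RHS]/(_ * _).
by have [->|] := eqVneq U S; rewrite ?mulr0.
Qed.

Lemma cl_revM x y : cl_rev (x * y) = cl_rev y * cl_rev x.
Proof.
have revM S T : cl_rev (cl_basis S * cl_basis T)
    = cl_rev (cl_basis T) * cl_rev (cl_basis S).
  rewrite cl_basisM linearZ /= !cl_rev_basis -scalerAl -scalerAr.
  rewrite cl_basisM (symdiffC T) !scalerA; congr (_ *: _).
  have sgn2 U : (-1) ^+ 'C(#|U|, 2) = (-1) ^+ #|U| * cl_sign R U U :> R.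
    by rewrite cl_sign_diag exprD mulrA -expr2 sqrr_sign mul1r.
  rewrite !sgn2 cl_sign_symdiffl !cl_sign_symdiffr sign_symdiff.
  set a := cl_sign R S T; have aa : a * a = 1 by rewrite -expr2 sqrr_sign.
  transitivity (a * a * ((-1) ^+ #|T| * cl_sign R T T *
    ((-1) ^+ #|S| * cl_sign R S S) * cl_sign R T S)); first by ring.
  by rewrite aa mul1r.
transitivity (\sum_S \sum_T
    (x S * y T) *: (cl_rev (cl_basis T) * cl_rev (cl_basis S))).
  rewrite {1}(cl_sumE x) {1}(cl_sumE y) mulr_suml linear_sum.
  apply: eq_bigr => S _; rewrite mulr_sumr linear_sum; apply: eq_bigr => T _.
  by rewrite -scalerAl -scalerAr !linearZ /= revM scalerA.
rewrite exchange_big [in RHS](cl_sumE x) [in RHS](cl_sumE y) !linear_sum.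
rewrite [RHS]mulr_suml; apply: eq_bigr => T _; rewrite [RHS]mulr_sumr.
by apply: eq_bigr => S _; rewrite !linearZ /= -scalerAl -scalerAr scalerA mulrC.
Qed.

Lemma cl_rev_vec (v : 'cV[R]_n) : cl_rev (cl_vec v) = cl_vec v.
Proof.
rewrite /cl_vec linear_sum; apply: eq_bigr => i _.
by rewrite linearZ /= cl_rev_basis cards1 scale1r.
Qed.
End CliffordAlgebra.

Section Spin.
Variables (R : realType) (n : nat).

Definition Spin (x : clifford R n) : Prop :=
  exists s : seq 'cV[R]_n,
    [/\ ~~ odd (size s),
        forall v, v \in s -> \sum_i v i 0 ^+ 2 = 1
      & x = \prod_(v <- s) cl_vec v].

(* The covering map lambda_n x : v |-> x v x^*, as a matrix; x^* = x^-1 on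
   Spin(n). *)
Definition spin_cover (x : clifford R n) : 'M[R]_n :=
  \matrix_(i, j) (x * cl_basis R [set j] * cl_rev x) [set i].

Lemma cl_vecE (v : 'cV[R]_n) i : cl_vec v [set i] = v i 0.
Proof.
rewrite sum_ffunE (bigD1 i) //= big1 ?addr0.
  by rewrite !ffunE eqxx -[LHS]/(_ * _) mulr1.
move=> j ji; rewrite !ffunE (inj_eq set1_inj) eq_sym (negPf ji).
exact: mulr0.
Qed.

Lemma cl_vec_delta (j : 'I_n) :
  cl_vec (delta_mx j 0 : 'cV[R]_n) = cl_basis R [set j].
Proof.
rewrite /cl_vec (bigD1 j) //= mxE !eqxx scale1r big1 ?addr0 // => i /negPf ij.
by rewrite mxE ij scale0r.
Qed.

Fact cl_vec_is_linear : linear (@cl_vec R n).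
Proof.
move=> a u v; rewrite /cl_vec scaler_sumr -big_split; apply: eq_bigr => i _.
by rewrite !mxE scalerDl scalerA.
Qed.
HB.instance Definition _ :=
  GRing.isLinear.Build R 'cV[R]_n (clifford R n) *:%R (@cl_vec R n)
    cl_vec_is_linear.

Lemma cl_vec_sqr (v : 'cV[R]_n) :
  \sum_i v i 0 ^+ 2 = 1 -> cl_vec v * cl_vec v = -1.
Proof.
move=> v1; have := cl_vec_anticomm v v.
under eq_bigr => i _ do rewrite -expr2.
rewrite v1 -mulr2n -scalerMnl scaleN1r => /(congr1 ( *:%R (2^-1 : R))).
by rewrite -!(@scaler_nat R) !scalerA mulVf ?pnatr_eq0 // !scale1r.
Qed.

Lemma Spin_rev (x : clifford R n) : Spin x -> x * cl_rev x = 1.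
Proof.
case=> s [s_even s1 ->].
suff -> : (\prod_(v <- s) cl_vec v) * cl_rev (\prod_(v <- s) cl_vec v)
    = (-1) ^+ size s by rewrite -signr_odd (negPf s_even).
elim: s s1 {s_even} => [|u s IHs] s1.
  by rewrite big_nil mul1r cl_rev_basis cards0 scale1r.
rewrite big_cons cl_revM cl_rev_vec mulrA -(mulrA (cl_vec u)) IHs.
  rewrite commr_sign -mulrA cl_vec_sqr ?exprSr //.
  by apply: s1; rewrite inE eqxx.
by move=> v vs; apply: s1; rewrite inE vs orbT.
Qed.

Lemma spin_coverE (x : clifford R n) (v : 'cV[R]_n) :
  Spin x -> x * cl_vec v * cl_rev x = cl_vec (spin_cover x *m v).
Proof.
case=> s [_ s1 ->]; set x0 := \prod_(u <- s) _.
have conj_vec w : exists w', x0 * cl_vec w * cl_rev x0 = cl_vec w'.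
  rewrite /x0 {x0}; elim: s s1 => [|u s IHs] s1.
    by exists w; rewrite big_nil mul1r cl_rev_basis cards0 scale1r mulr1.
  have [|w' Ew'] := IHs; first by move=> z zs; apply: s1; rewrite inE zs orbT.
  have uu : cl_vec u * cl_vec u = -1 by apply/cl_vec_sqr/s1; rewrite inE eqxx.
  exists (w' - ((\sum_i u i 0 * w' i 0) *+ 2) *: u).
  rewrite big_cons cl_revM cl_rev_vec; set p := \prod_(z <- s) _ in Ew' *.
  have -> : cl_vec u * p * cl_vec w * (cl_rev p * cl_vec u)
    = cl_vec u * (p * cl_vec w * cl_rev p) * cl_vec u by rewrite !mulrA.
  rewrite Ew'.
  have /(canRL (addrK _)) -> := cl_vec_anticomm u w'.
  rewrite mulrBl -mulrA uu mulrN1 opprK -scalerAl mul1r addrC.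
  by rewrite linearB linearZ /= mulNrn scaleNr.
have E j : x0 * cl_basis R [set j] * cl_rev x0 = cl_vec (col j (spin_cover x0)).
  have [w' E] := conj_vec (delta_mx j 0); rewrite -cl_vec_delta E.
  congr cl_vec; apply/colP => i.
  by rewrite !mxE -cl_vec_delta E cl_vecE.
have -> : spin_cover x0 *m v = \sum_j v j 0 *: col j (spin_cover x0).
  apply/colP => i; rewrite mxE summxE; apply: eq_bigr => j _.
  by rewrite !mxE mulrC.
rewrite {1}/cl_vec mulr_sumr mulr_suml linear_sum.
by apply: eq_bigr => j _; rewrite linearZ /= -E -scalerAr -scalerAl.
Qed.
End Spin.

(* (D, t) stands for the map x |-> D x + t; the isometries are those with D
   orthogonal, and these are closed under the operations below. *)
Definition affinity (R : realType) (n : nat) : Type :=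
  ('M[R]_n * 'cV[R]_n)%type.

Section FlatManifolds.
Variables (R : realType) (n : nat).
Local Notation aff := (affinity R n).
Implicit Types g h : aff.

Definition aff_one : aff := (1%:M, 0).
Definition aff_mul g h : aff := (g.1 *m h.1, g.1 *m h.2 + g.2).
Definition aff_inv g : aff := (invmx g.1, - (invmx g.1 *m g.2)).

Inductive aff_gen (X : aff -> Prop) : aff -> Prop :=
  | aff_gen_in g : X g -> aff_gen X g
  | aff_gen_one : aff_gen X aff_one
  | aff_gen_mul g h : aff_gen X g -> aff_gen X h -> aff_gen X (aff_mul g h)
  | aff_gen_inv g : aff_gen X g -> aff_gen X (aff_inv g).

(* A flat manifold R^n / Gamma is given by its fundamental group Gamma.  The
   values of eps outside Gamma are irrelevant: eps stands for a homomorphism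
   Gamma -> Spin(n). *)
Definition has_spin_structure (Gamma : aff -> Prop) : Prop :=
  (forall g, Gamma g -> \det g.1 = 1) /\
  exists eps : aff -> clifford R n,
    [/\ forall g, Gamma g -> Spin (eps g),
        forall g h, Gamma g -> Gamma h -> eps (aff_mul g h) = eps g * eps h
      & forall g, Gamma g -> spin_cover (eps g) = g.1].

Definition bott_gen (A : 'M['F_2]_n) (i : 'I_n) : aff :=
  (diag_mx (\row_j (-1) ^+ (A i j : nat)), 2^-1 *: delta_mx i 0).

Definition bott_group (A : 'M['F_2]_n) : aff -> Prop :=
  aff_gen (fun g => exists i, g = bott_gen A i).
End FlatManifolds.

Arguments bott_gen R {n} A i.
Arguments bott_group R {n} A _.

Definition strictly_upper_triangular (n : nat) (B : 'M['F_2]_n) : Prop :=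
  forall i j : 'I_n, (j <= i)%N -> B i j = 0.

Definition bott_matrix (n : nat) (A : 'M['F_2]_n) : Prop :=
  exists (s : 'S_n) (B : 'M['F_2]_n), strictly_upper_triangular B /\
    A = perm_mx s *m B *m invmx (perm_mx s).

Definition two_rows (n : nat) (A : 'M['F_2]_n) (i j : 'I_n) : 'M['F_2]_n :=
  \matrix_(l, m) if (l == i) || (l == j) then A l m else 0.

(* Main.v *)
(* Let D_i be the linear part of s_i and S_i the set of coordinates it flips.
   For orientable M(A), every S_i is even and the lifts of s_i to Spin(n) are
   +- e_(S_i), e_S being the product of the basis vectors indexed by S.  For an
   order making A strictly triangular, Gamma(A) is presented by the relations
   s_i s_j s_i^-1 = s_j^(+-1), i before j, so a Spin structure exists iff the
   elements e_(S_i) satisfy them; the signs cancel.  Each relation involves two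
   rows of A only, and those of A_ij beyond the one for i, j are trivial. *)

Require Import Defs.
From mathcomp Require Import all_boot all_order all_fingroup all_algebra.
From mathcomp Require Import reals ring zify.

Set Implicit Arguments.
Unset Strict Implicit.
Unset Printing Implicit Defensive.
Import Order.TTheory GRing.Theory Num.Theory.
Local Open Scope ring_scope.

(** * Integer powers of elements whose fourth power is 1 *)

Section ZPower.
Variable T : nzRingType.
Implicit Types (x y : T) (k l : int).

(* Meant for [x ^+ 4 = 1], where it is the integer power [x ^ k]. *)
Definition zpow4 x k : T := x ^+ `|(k %% 4)%Z|.

Lemma zpow4_nat x n : x ^+ 4 = 1 -> zpow4 x n%:Z = x ^+ n.
Proof.
move=> x4; rewrite /zpow4 modz_nat absz_nat.
by rewrite [in RHS](divn_eq n 4) mulnC exprD exprM x4 expr1n mul1r.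
Qed.

Lemma eq_zpow4 x k l : (k = l %[mod 4])%Z -> zpow4 x k = zpow4 x l.
Proof. by rewrite /zpow4 => ->. Qed.

Lemma zpow4D x k l : x ^+ 4 = 1 -> zpow4 x (k + l) = zpow4 x k * zpow4 x l.
Proof.
move=> x4; rewrite {2 3}/zpow4 -exprD -(zpow4_nat _ x4); apply: eq_zpow4.
rewrite PoszD !gez0_abs ?modz_ge0 //.
by rewrite modzDml modzDmr.
Qed.

Lemma zpow4X x k n : x ^+ 4 = 1 -> zpow4 x k ^+ n = zpow4 x (k * n%:Z).
Proof.
move=> x4; elim: n => [|n IHn]; first by rewrite mulr0 expr0.
by rewrite exprS IHn -zpow4D // intS mulrDr mulr1.
Qed.

Lemma zpow4_twist x y k l : x ^+ 4 = 1 ->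
  y * x = zpow4 x l * y -> y * zpow4 x k = zpow4 x (l * k) * y.
Proof.
move=> x4 yx; have yxn n : y * x ^+ n = zpow4 x l ^+ n * y.
  elim: n => [|n IHn]; first by rewrite !expr0 mulr1 mul1r.
  by rewrite exprSr mulrA IHn -mulrA yx mulrA exprSr.
rewrite {1}/zpow4 yxn zpow4X //; congr (_ * _); apply: eq_zpow4.
by rewrite gez0_abs ?modz_ge0 // modzMmr.
Qed.

Lemma odd_modz4 k : odd `|(k %% 4)%Z| = odd `|k|.
Proof. lia. Qed.

(** Each factor [y] moved past a power of [x] multiplies its exponent by the same sign, so only the
    parity of [l] counts, and reduction modulo 4 keeps that parity. *)
Lemma zpow4_twist_zpow4 x y k l (b : bool) : x ^+ 4 = 1 ->
  y * x = zpow4 x ((-1) ^+ b) * y ->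
  zpow4 y l * zpow4 x k = zpow4 x ((-1) ^+ (odd `|l| && b) * k) * zpow4 y l.
Proof.
move=> x4 yx; rewrite -odd_modz4 /(zpow4 y); move: `|_|%N => n.
elim: n => [|n IHn] /=; first by rewrite mul1r mulr1 mul1r.
rewrite exprS -mulrA IHn mulrA (zpow4_twist _ x4 yx) -mulrA -exprS.
rewrite mulrA -signr_addb.
by case: (odd n); case: b {yx IHn}.
Qed.
End ZPower.

(** * Parities and commutation signs of the Clifford basis *)

Lemma odd_card_symdiff (n : nat) (S T : {set 'I_n}) :
  odd #|symdiff S T| = odd #|S| (+) odd #|T|.
Proof.
have := sign_symdiff int S T; rewrite -exprD -signr_odd -[RHS]signr_odd oddD.
by case: (odd #|_|); case: (_ (+) _).
Qed.

Section CliffordSigns.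
Variables (R : comNzRingType) (n : nat).
Implicit Types (S T U : {set 'I_n}) (j : 'I_n).
Local Notation e := (cl_basis R).

(** An [i] in [S] other than [j] is counted in exactly one of the two signs, and [i = j] in both. *)
Lemma cl_sign_set1_comm S j :
  cl_sign R S [set j] * cl_sign R [set j] S = (-1) ^+ #|S| * (-1) ^+ (j \in S).
Proof.
have signl : cl_sign R S [set j] = \prod_i (-1) ^+ ((i \in S) && (j <= i)%N).
  rewrite cl_signE -(pair_bigA _ (fun i k : 'I_n =>
    (-1) ^+ [&& i \in S, k \in [set j] & (k <= i)%N])) /=.
  apply: eq_bigr => i _; rewrite (bigD1 j) //= inE eqxx big1 ?mulr1 // => k.
  by rewrite inE => /negPf->; rewrite andbF.
have signr : cl_sign R [set j] S = \prod_i (-1) ^+ ((i \in S) && (i <= j)%N).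
  rewrite cl_signE -(pair_bigA _ (fun i k : 'I_n =>
    (-1) ^+ [&& i \in [set j], k \in S & (k <= i)%N])) /= exchange_big /=.
  apply: eq_bigr => i _; rewrite (bigD1 j) //= inE eqxx big1 ?mulr1 // => k.
  by rewrite inE => /negPf->.
have -> : (-1) ^+ #|S| = \prod_i (-1) ^+ (i \in S) :> R.
  by rewrite prodrXr -sum1_card big_mkcond.
have -> : (-1) ^+ (j \in S) = \prod_i (-1) ^+ ((i \in S) && (i == j)) :> R.
  rewrite (bigD1 j) //= eqxx andbT big1 ?mulr1 // => i /negPf->.
  by rewrite andbF.
rewrite signl signr -!big_split; apply: eq_bigr => i _ /=.
rewrite -!signr_addb -(inj_eq val_inj) /=.
by case: (i \in S) => //=; case: ltngtP.
Qed.

Lemma cl_basis_comm S j : ~~ odd #|S| ->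
  e S * e [set j] = (-1) ^+ (j \in S) *: (e [set j] * e S).
Proof.
move=> S_even; rewrite !cl_basisM (symdiffC [set j]) scalerA; congr (_ *: _).
have := cl_sign_set1_comm S j; rewrite -signr_odd (negPf S_even) mul1r => <-.
by rewrite -mulrA -expr2 sqrr_sign mulr1.
Qed.

(** The square of [e S] is a sign; hence exponents of [e S] may be read modulo 4. *)
Lemma cl_basis_expr4 S : e S ^+ 4 = 1.
Proof.
rewrite (exprM _ 2 2) (expr2 (e S)) cl_basisM symdiffss exprZn sqrr_sign.
by rewrite scale1r (_ : e set0 = 1) ?expr1n.
Qed.

Lemma cl_revK : involutive (@cl_rev R n).
Proof.
by move=> x; apply/ffunP => S; rewrite !ffunE mulrA -expr2 sqrr_sign mul1r.
Qed.
End CliffordSigns.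

(** * Diagonal sign matrices, multiplied by pointwise [addb] *)

Definition sign_mx (R : pzRingType) (n : nat) (p : 'I_n -> bool) : 'M[R]_n :=
  diag_mx (\row_j (-1) ^+ p j).

Section SignMatrices.
Variables (R : comNzRingType) (n : nat).
Implicit Types p q : 'I_n -> bool.

Lemma eq_sign_mx p q : p =1 q -> sign_mx R p = sign_mx R q.
Proof. by move=> pq; congr diag_mx; apply/rowP => j; rewrite !mxE pq. Qed.

Lemma sign_mx0 : sign_mx R (fun _ : 'I_n => false) = 1%:M.
Proof. by apply/matrixP => i j; rewrite !mxE. Qed.

Lemma sign_mxM p q :
  sign_mx R p *m sign_mx R q = sign_mx R (fun j => p j (+) q j).
Proof.
rewrite mulmx_diag; congr diag_mx; apply/rowP => j; rewrite !mxE.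
by rewrite -signr_addb.
Qed.

Lemma sign_mx_col p (v : 'cV[R]_n) i :
  (sign_mx R p *m v) i 0 = (-1) ^+ p i * v i 0.
Proof. by rewrite mul_diag_mx !mxE. Qed.

Lemma det_sign_mx (S : {set 'I_n}) :
  \det (sign_mx R (fun j => j \in S)) = (-1) ^+ #|S|.
Proof.
rewrite det_diag; under eq_bigr do rewrite mxE.
by rewrite prodrXr -sum1_card [in RHS]big_mkcond.
Qed.
End SignMatrices.

(** * The Spin group and the fibres of its covering map over sign matrices *)

Section SpinGroup.
Variables (R : realType) (n : nat).
Implicit Types (x y : clifford R n) (S T U : {set 'I_n}).
Local Notation e := (cl_basis R).

Lemma Spin1 : Spin (1 : clifford R n).
Proof. by exists [::]; rewrite big_nil. Qed.

Lemma SpinM x y : Spin x -> Spin y -> Spin (x * y).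
Proof.
move=> [s [s_even s1 ->]] [t [t_even t1 ->]]; exists (s ++ t); split.
- by rewrite size_cat oddD (negPf s_even) (negPf t_even).
- by move=> v; rewrite mem_cat => /orP[/s1|/t1].
- by rewrite big_cat.
Qed.

Lemma SpinX x m : Spin x -> Spin (x ^+ m).
Proof.
move=> sx; elim: m => [|m IHm]; first exact: Spin1.
by rewrite exprS; apply: SpinM.
Qed.

Lemma Spin_cl_rev x : Spin x -> Spin (cl_rev x).
Proof.
case=> s [s_even s1 ->]; exists (rev s); split; first by rewrite size_rev.
  by move=> v; rewrite mem_rev => /s1.
elim: s {s_even s1} => [|v s IHs].
  by rewrite !big_nil cl_rev_basis cards0 scale1r.
by rewrite big_cons cl_revM cl_rev_vec IHs rev_cons -cats1 big_cat big_seq1.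
Qed.

Lemma Spin_rev_mul x : Spin x -> cl_rev x * x = 1.
Proof. by move=> /Spin_cl_rev/Spin_rev; rewrite cl_revK. Qed.

(** For every [S], of either parity, [e S] is a product of [#|S|] unit vectors, by induction
    splitting off one basis vector. *)
Lemma Spin_basis S : ~~ odd #|S| -> Spin (e S).
Proof.
suff [s [sz s1 ->]] : exists s : seq 'cV[R]_n, [/\ size s = #|S|,
    forall v, v \in s -> \sum_i v i 0 ^+ 2 = 1 & e S = \prod_(v <- s) cl_vec v].
  by move=> S_even; exists s; rewrite sz.
have [m] := ubnP #|S|; elim: m S => // m IHm S.
have [->|[j jS]] := set_0Vmem S; first by exists [::]; rewrite big_nil cards0.
rewrite (cardsD1 j) jS add1n ltnS => /IHm[s [sz s1 eSj]].
have SE : S = symdiff [set j] (S :\ j).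
  by apply/setP => i; rewrite !inE; case: eqVneq => [->|]; rewrite ?jS.
(* The sign in [e_j e_(S :\ j) = +- e_S] is absorbed by the unit vector. *)
pose a := cl_sign R [set j] (S :\ j).
have aa : a ^+ 2 = 1 by rewrite sqrr_sign.
exists (a *: delta_mx j 0 :: s); split; first by rewrite /= sz.
- move=> v; rewrite inE => /orP[/eqP->|/s1 //].
  rewrite (bigD1 j) //= !mxE !eqxx mulr1 aa big1 ?addr0 // => i /negPf ij.
  by rewrite !mxE ij mulr0 expr0n.
- rewrite big_cons -eSj linearZ /= cl_vec_delta -scalerAl cl_basisM scalerA.
  by rewrite -expr2 aa scale1r -SE.
Qed.

(** This is the grading modulo 2: a vector is supported on singletons, and the symmetric difference
    with a singleton changes the parity of a set. *)
Lemma cl_prod_vec_parity (s : seq 'cV[R]_n) U :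
  (\prod_(v <- s) cl_vec v) U != 0 -> odd #|U| = odd (size s).
Proof.
elim: s U => [|v s IHs] U.
  by rewrite big_nil ffunE; case: (U =P set0) => [->|]; rewrite ?cards0 ?eqxx.
rewrite big_cons; apply: contra_neq_eq => odd_neq; rewrite cl_mulE.
apply: big1 => S _; have [S1|S1] := eqVneq #|S| 1%N; last first.
  rewrite sum_ffunE big1 ?mulr0 ?mul0r // => i _.
  rewrite !ffunE.
  by case: (S =P [set i]) S1 => [->|_]; rewrite ?cards1 ?scaler0.
have [->|/IHs] := eqVneq ((\prod_(w <- s) cl_vec w) (symdiff S U)) 0.
  by rewrite mulr0.
rewrite odd_card_symdiff S1 => /= odd_eq; case/eqP: odd_neq.
by rewrite /= -odd_eq negbK.
Qed.

Lemma Spin_even x U : Spin x -> odd #|U| -> x U = 0.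
Proof.
case=> s [s_even _ ->] U_odd; apply/eqP; apply: contraNT s_even.
by move/cl_prod_vec_parity <-.
Qed.

Lemma spin_coverM x y : Spin x -> Spin y ->
  spin_cover (x * y) = spin_cover x *m spin_cover y.
Proof.
move=> sx sy; apply/matrixP => i j; rewrite [LHS]mxE cl_revM -cl_vec_delta.
have -> : x * y * cl_vec (delta_mx j 0) * (cl_rev y * cl_rev x) =
    x * (y * cl_vec (delta_mx j 0) * cl_rev y) * cl_rev x by rewrite !mulrA.
rewrite (spin_coverE _ sy) (spin_coverE _ sx) cl_vecE mulmxA -colE.
by rewrite [LHS]mxE.
Qed.

Lemma spin_cover_basis S : ~~ odd #|S| ->
  spin_cover (e S) = sign_mx R (fun j => j \in S).
Proof.
move=> S_even; apply/matrixP => i j; rewrite !mxE cl_basis_comm //.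
rewrite -scalerAl -mulrA Spin_rev ?mulr1; last exact: Spin_basis.
rewrite !ffunE (inj_eq set1_inj) -[LHS]/(_ * _).
by case: eqVneq => [->|_]; rewrite ?mulr0 ?mulr1.
Qed.

Lemma spin_cover1 : spin_cover (1 : clifford R n) = 1%:M.
Proof.
rewrite (_ : 1 = e set0) // spin_cover_basis ?cards0 // -sign_mx0.
by apply: eq_sign_mx => j; rewrite inE.
Qed.

Lemma spin_cover_zpow4_basis S k : ~~ odd #|S| ->
  spin_cover (zpow4 (e S) k) = sign_mx R (fun j => odd `|k| && (j \in S)).
Proof.
move=> S_even; rewrite -odd_modz4 /zpow4; move: `|_|%N => m.
elim: m => [|m IHm] /=; first by rewrite spin_cover1 -sign_mx0.
have sS := Spin_basis S_even.
rewrite exprS spin_coverM ?spin_cover_basis ?IHm ?sign_mxM //; last first.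
  exact: SpinX.
by apply: eq_sign_mx => j /=; case: (j \in S); case: (odd m).
Qed.

(* If [x e_j = +- e_j x] for all [j], each basis element [e_U] occurring in [x]
   obeys the same commutation rules, and for even [U] these determine [U]. *)
Lemma spin_cover_sign_mx x T : Spin x ->
  spin_cover x = sign_mx R (fun j => j \in T) ->
  exists2 c : R, c * c = 1 & x = c *: e T.
Proof.
move=> sx xT.
have x_comm j : x * e [set j] = (-1) ^+ (j \in T) *: (e [set j] * x).
  have := spin_coverE (delta_mx j 0) sx; rewrite xT cl_vec_delta.
  have -> : sign_mx R (fun i => i \in T) *m delta_mx j 0 =
      (-1) ^+ (j \in T) *: (delta_mx j 0 : 'cV[R]_n).
    apply/colP => i; rewrite sign_mx_col !mxE eqxx andbT.
    by case: eqVneq => [->|_]; rewrite ?mulr0.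
  rewrite linearZ /= cl_vec_delta => /(congr1 (fun y => y * x)).
  by rewrite -[LHS]mulrA Spin_rev_mul // mulr1 -scalerAl.
have suppx U : U != T -> x U = 0.
  move=> UT; have [/(Spin_even sx)//|U_even] := boolP (odd #|U|).
  have {UT} [j jUT] : exists j, (j \in U) != (j \in T).
    apply/existsP; apply: contraNT UT; rewrite negb_exists => /forallP UT.
    by apply/eqP/setP => j; apply/eqP; rewrite -[_ == _]negbK UT.
  (* In this coordinate only the term [S = U] survives on the left and only [S = [set j]] on the
     right, so both sides are signed multiples of [x U]. *)
  have := congr1 (fun y : clifford R n => y (symdiff U [set j])) (x_comm j).
  rewrite /= cl_mulE (bigD1 U) //= big1 ?addr0 => [|S SU]; last first.
    rewrite ffunE -symdiff_eq0 -!symdiffA symdiffss (symdiffC _ set0) symdiff0s.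
    by rewrite symdiff_eq0 (negPf SU) mulr0.
  rewrite [RHS]ffunE -[RHS]/(_ * _) cl_mulE (bigD1 [set j]) //= big1 ?addr0.
    rewrite symdiffK (symdiffC U) symdiffK !ffunE !eqxx !mulr1.
    have := cl_sign_set1_comm R U j; rewrite -signr_odd (negPf U_even) mul1r.
    set a := cl_sign R _ _; set b := cl_sign R _ _ => ab.
    have bb : b * b = 1 by rewrite -expr2 sqrr_sign.
    move/(congr1 (fun t => t * b)); rewrite [LHS]mulrAC ab => E.
    have {}E : (-1) ^+ (j \in U) * x U = (-1) ^+ (j \in T) * x U.
      by rewrite E -[RHS]mulr1 -bb; ring.
    (* As [j] lies in exactly one of [U] and [T], the two signs are opposite. *)
    have {E} : x U *+ 2 = 0.
      case: (j \in U) (j \in T) jUT E => -[] //= _.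
        rewrite expr1 mulN1r mul1r => E; by rewrite mulr2n -{1}E addNr.
      rewrite expr1 mulN1r mul1r => E; by rewrite mulr2n {1}E addNr.
    by move/eqP; rewrite mulrn_eq0 => /eqP.
  by move=> S /negPf Sj; rewrite ffunE Sj mulr0 mul0r.
have xE : x = x T *: e T.
  rewrite {1}(cl_sumE x) (bigD1 T) //= big1 ?addr0 // => S /suppx->.
  by rewrite scale0r.
exists (x T) => //.
(* An odd [T] would force [x = 0]; for even [T], comparing [x * cl_rev x = 1] with
   [e T * cl_rev (e T) = 1] gives the square of the scalar. *)
have [T_odd|T_even] := boolP (odd #|T|).
  have x0 : x = 0 by rewrite xE (Spin_even sx T_odd) scale0r.
  by have /eqP := Spin_rev sx; rewrite x0 mul0r eq_sym oner_eq0.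
have := Spin_rev sx; rewrite {1 2}xE linearZ /= -scalerAl -scalerAr scalerA.
rewrite Spin_rev; last exact: Spin_basis.
move/ffunP/(_ set0); rewrite !ffunE eqxx -[LHS]/(_ * _).
by rewrite !mulr1.
Qed.
End SpinGroup.

(** * Relations of the Bott group and their necessity for the lifts *)

Definition row_support (n : nat) (A : 'M['F_2]_n) (i : 'I_n) : {set 'I_n} :=
  [set j | A i j != 0].

(* The relation [s_i s_j = s_j^(+-1) s_i] of the Bott group, read on the lifts
   [x] of [s_i] and [y] of [s_j]; the exponent is [-1] when [b] holds. *)
Definition bott_relation (T : pzRingType) (b : bool) (x y : T) : Prop :=
  if b then y * x * y = x else x * y = y * x.

Section BottSpin.
Variables (R : realType) (n : nat) (A : 'M['F_2]_n) (r : 'I_n -> nat).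
Hypothesis A_acyclic : forall i j, A i j != 0 -> (r i < r j)%N.
Local Notation S := (row_support A).
Local Notation e := (cl_basis R).
Local Notation Gamma := (bott_group R A).
Implicit Types (m : 'I_n -> int) (i j : 'I_n).

Lemma bott_genE i :
  bott_gen R A i = (sign_mx R (fun j => j \in S i), 2^-1 *: delta_mx i 0).
Proof.
congr (diag_mx _, _); apply/rowP => j; rewrite !mxE inE.
by case: (A i j) => -[|[|]].
Qed.

Lemma row_support_irr i : i \notin S i.
Proof. by apply/negP; rewrite inE => /A_acyclic; rewrite ltnn. Qed.

(** The relation is written without inverses. The linear parts are commuting involutions; for the
    translations only coordinates [i] and [j] matter, and [s_j] does not flip coordinate [i]. *)
Lemma bott_gen_relation i j : i != j -> i \notin S j ->
  let si := bott_gen R A i in let sj := bott_gen R A j in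
  if j \in S i then aff_mul sj (aff_mul si sj) = si
  else aff_mul si sj = aff_mul sj si.
Proof.
move=> ij iSj; rewrite /= !bott_genE; case: ifPn => jSi.
  rewrite /aff_mul /= !sign_mxM; congr (_, _).
    by apply: eq_sign_mx => l; rewrite addbCA addbb addbF.
  apply/colP => l; rewrite [LHS]mxE sign_mx_col [X in _ * X]mxE sign_mx_col.
  rewrite !mxE !eqxx !andbT.
  have [->|li] := eqVneq l i.
    by rewrite (negPf ij) (negPf iSj) !mulr0 addr0 add0r mul1r.
  rewrite mulr0 addr0; have [->|lj] := eqVneq l j; last by rewrite !mulr0 addr0.
  by rewrite (negPf (row_support_irr j)) jSi; ring.
rewrite /aff_mul /= !sign_mxM; congr (_, _).
  by apply: eq_sign_mx => l; rewrite addbC.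
apply/colP => l; rewrite [LHS]mxE [RHS]mxE !sign_mx_col !mxE !eqxx !andbT.
have [->|li] := eqVneq l i.
  by rewrite (negPf ij) (negPf iSj) !mulr0 addr0 add0r mul1r.
have [->|lj] := eqVneq l j; last by rewrite !mulr0.
by rewrite (negPf jSi) !mulr0 addr0 add0r mul1r.
Qed.

Lemma spin_structure_even : has_spin_structure Gamma ->
  forall i, ~~ odd #|S i|.
Proof.
case=> detG _ i; have := detG (bott_gen R A i).
rewrite bott_genE det_sign_mx -signr_odd -bott_genE.
have Gi : Gamma (bott_gen R A i) by apply: aff_gen_in; exists i.
move/(_ Gi); case: odd => //= /eqP.
by rewrite expr1 eq_sym -addr_eq0 -(mulr2n 1) pnatr_eq0.
Qed.

(** The lifts given by [eps] are [c *: e (S i)] and [d *: e (S j)] with [c] and [d] of square 1. In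
    either form of the relation these scalars cancel. *)
Lemma spin_structure_relation : has_spin_structure Gamma ->
  forall i j, i != j -> i \notin S j ->
  bott_relation (j \in S i) (e (S i)) (e (S j)).
Proof.
case=> _ [eps [epsS epsM epsC]] i j ij iSj.
have Gs l : Gamma (bott_gen R A l) by apply: aff_gen_in; exists l.
have eps_gen l : exists2 c : R, c * c = 1 & eps (bott_gen R A l) = c *: e (S l).
  by apply: spin_cover_sign_mx; [apply: epsS | rewrite epsC // bott_genE].
have [c cc epsi] := eps_gen i; have [d dd epsj] := eps_gen j.
have scaleI (a : R) (x y : clifford R n) :
    a * a = 1 -> a *: x = a *: y -> x = y.
  by move=> aa /(congr1 ( *:%R a)); rewrite !scalerA aa !scale1r.
have := bott_gen_relation ij iSj; rewrite /bott_relation /=; case: ifP => _ E.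
  have Gij := aff_gen_mul (Gs i) (Gs j).
  have := congr1 eps E; rewrite (epsM _ _ (Gs j) Gij) (epsM _ _ (Gs i) (Gs j)).
  rewrite epsi epsj -!scalerAr -!scalerAl -?scalerAr !scalerA mulrA => E'.
  apply: (scaleI c) => //; rewrite -[in RHS]E'; congr (_ *: _).
  by rewrite -{1}[c]mul1r -dd; ring.
have := congr1 eps E; rewrite (epsM _ _ (Gs i) (Gs j)) (epsM _ _ (Gs j) (Gs i)).
rewrite epsi epsj -!scalerAr -!scalerAl !scalerA.
rewrite (mulrC d c); apply: scaleI.
by rewrite mulrACA cc dd mulr1.
Qed.

(** * Normal form of the elements of the Bott group *)

(* The element of the Bott group with translation part [m / 2] has linear part
   [\prod_i D_i ^ m_i]: the parities of the coordinates of twice the translation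
   add up under products, since linear parts only change signs. *)
Definition bott_sign m j : bool :=
  \big[addb/false]_i (odd `|m i| && (j \in S i)).

Definition bott_elt m : affinity R n :=
  (sign_mx R (bott_sign m), \col_j ((m j)%:~R / 2)).

(** The law on integer vectors that [bott_elt] carries to [aff_mul]. *)
Definition twist_mul m m' j : int := m j + (-1) ^+ bott_sign m j * m' j.

Definition twist_inv m j : int := - ((-1) ^+ bott_sign m j * m j).

Lemma eq_bott_sign m m' : (forall i, odd `|m i| = odd `|m' i|) ->
  bott_sign m =1 bott_sign m'.
Proof. by move=> mm' j; apply: eq_bigr => i _; rewrite mm'. Qed.

Lemma bott_sign_twist_mul m m' j :
  bott_sign (twist_mul m m') j = bott_sign m j (+) bott_sign m' j.
Proof.
rewrite -big_split; apply: eq_bigr => i _ /=; rewrite -andb_addl /twist_mul.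
by congr (_ && _); case: (bott_sign m i); rewrite ?expr0 ?expr1; lia.
Qed.

Lemma bott_elt_mul m m' :
  aff_mul (bott_elt m) (bott_elt m') = bott_elt (twist_mul m m').
Proof.
rewrite /aff_mul /= sign_mxM; congr (_, _).
  by apply: eq_sign_mx => j; rewrite bott_sign_twist_mul.
apply/colP => j; rewrite mxE sign_mx_col !mxE rmorphD rmorphM rmorphXn /=.
by rewrite rmorphN1 mulrDl mulrA addrC.
Qed.

Lemma bott_elt_inv m : aff_inv (bott_elt m) = bott_elt (twist_inv m).
Proof.
have DD : sign_mx R (bott_sign m) *m sign_mx R (bott_sign m) = 1%:M.
  by rewrite sign_mxM -sign_mx0; apply: eq_sign_mx => j; rewrite addbb.
have [Du _] := mulmx1_unit DD.
have DV : invmx (sign_mx R (bott_sign m)) = sign_mx R (bott_sign m).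
  by rewrite -[LHS]mulmx1 -DD mulKmx.
rewrite /aff_inv /= DV; congr (_, _).
  apply: eq_sign_mx; apply: eq_bott_sign => i; rewrite /twist_inv.
  by case: (bott_sign m i); rewrite ?expr0 ?expr1; lia.
apply/colP => j; rewrite mxE sign_mx_col !mxE rmorphN rmorphM rmorphXn /=.
by rewrite rmorphN1 mulrA mulNr.
Qed.

(** An element is thus determined by its translation, so a lift can be defined by a formula in [m]
    rather than through a presentation of the group. *)
Lemma bott_group_elt g : Gamma g -> exists m, g = bott_elt m.
Proof.
elim=> [_ [i ->]||_ _ _ [m ->] _ [m' ->]|_ _ [m ->]].
- exists (fun j => (j == i)%:R); rewrite bott_genE; congr (_, _).
    apply: eq_sign_mx => j.
    rewrite /bott_sign (bigD1 i) //= eqxx big1 ?addbF //.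
    by move=> l /negPf->.
  apply/colP => j; rewrite !mxE eqxx andbT.
  by case: (j == i); rewrite ?mulr0 ?mulr1 ?mul0r ?mul1r.
- exists (fun=> 0); congr (_, _); last by apply/colP => j; rewrite !mxE mul0r.
  by rewrite -sign_mx0; apply: eq_sign_mx => j; rewrite /bott_sign big1.
- by exists (twist_mul m m'); apply: bott_elt_mul.
- by exists (twist_inv m); apply: bott_elt_inv.
Qed.

(** * Construction of the lift from the relations *)

(* Listing [i] by decreasing [r i], the element with translation [m / 2] is the
   product of the [s_i ^ m_i], as [s_j] fixes the coordinates after [j]. *)
Definition bott_order : seq 'I_n :=
  sort (fun i j => (r j <= r i)%N) (enum 'I_n).

Definition bott_lift_seq (s : seq 'I_n) m : clifford R n :=
  \prod_(i <- s) zpow4 (e (S i)) (m i).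

Definition bott_lift := bott_lift_seq bott_order.

Hypothesis S_even : forall i, ~~ odd #|S i|.
Hypothesis S_rel : forall i j, i != j -> i \notin S j ->
  bott_relation (j \in S i) (e (S i)) (e (S j)).

Lemma bott_lift_twist i j k l : i != j -> i \notin S j ->
  zpow4 (e (S i)) l * zpow4 (e (S j)) k =
  zpow4 (e (S j)) ((-1) ^+ (odd `|l| && (j \in S i)) * k) * zpow4 (e (S i)) l.
Proof.
move=> ij iSj; apply: zpow4_twist_zpow4; first exact: cl_basis_expr4.
have := S_rel ij iSj; rewrite /bott_relation; case: ifP => _ E.
  (* The exponent -1 is 3 modulo 4; expanding [e (S i)] by the relation then produces a fourth
     power. *)
  rewrite [zpow4 _ _](_ : _ = e (S j) ^+ 3) // -[in RHS]E !mulrA -exprSr.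
  by rewrite cl_basis_expr4 mul1r.
by rewrite (zpow4_nat 1 (cl_basis_expr4 _ _)).
Qed.

Lemma Spin_bott_lift_seq s m : Spin (bott_lift_seq s m).
Proof.
elim: s => [|i s IHs]; first by rewrite /bott_lift_seq big_nil; apply: Spin1.
by rewrite /bott_lift_seq big_cons; apply: SpinM => //; apply/SpinX/Spin_basis.
Qed.

Lemma spin_cover_bott_lift m :
  spin_cover (bott_lift m) = sign_mx R (bott_sign m).
Proof.
have -> : sign_mx R (bott_sign m) = sign_mx R (fun j =>
    \big[addb/false]_(i <- bott_order) (odd `|m i| && (j \in S i))).
  apply: eq_sign_mx => j; rewrite /bott_sign -big_enum; apply: perm_big.
  by rewrite perm_sym; apply/permPl/perm_sort.
rewrite /bott_lift; elim: bott_order => [|i s IHs].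
  rewrite /bott_lift_seq big_nil spin_cover1 -sign_mx0.
  by apply: eq_sign_mx => j; rewrite big_nil.
rewrite /bott_lift_seq big_cons spin_coverM ?IHs.
- rewrite spin_cover_zpow4_basis // sign_mxM.
  by apply: eq_sign_mx => j; rewrite big_cons.
- exact/SpinX/Spin_basis.
- exact: Spin_bott_lift_seq.
Qed.

Lemma bott_lift_seq_twist s m j k :
  all (fun i => (i != j) && (i \notin S j)) s ->
  let b := \big[addb/false]_(i <- s) (odd `|m i| && (j \in S i)) in
  bott_lift_seq s m * zpow4 (e (S j)) k =
  zpow4 (e (S j)) ((-1) ^+ b * k) * bott_lift_seq s m.
Proof.
rewrite /bott_lift_seq /=; elim: s => [|i s IHs] /=.
  by rewrite !big_nil mul1r mulr1 expr0 mul1r.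
case/andP => /andP[ij iSj] /IHs E.
rewrite !big_cons /= signr_addb -[LHS]mulrA E [LHS]mulrA bott_lift_twist //.
by rewrite -[LHS]mulrA (mulrA _ _ k).
Qed.

(** Induction on the suffixes of [bott_order]. With head [j], moving the power [m' j] of [e (S j)]
    left past the tail of the lift of [m] gives its exponent the sign prescribed by [twist_mul]. *)
Lemma bott_liftM m m' : bott_lift (twist_mul m m') = bott_lift m * bott_lift m'.
Proof.
have suffix_mul s p : p ++ s = bott_order ->
    bott_lift_seq s (twist_mul m m') = bott_lift_seq s m * bott_lift_seq s m'.
  elim: s p => [|j s IHs] p ps; first by rewrite /bott_lift_seq !big_nil mul1r.
  have {}IHs := IHs (rcons p j) (etrans (cat_rcons _ _ _) ps).
  have order_perm : perm_eq (p ++ j :: s) (enum 'I_n).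
    by rewrite ps; apply/permPl/perm_sort.
  have : sorted (fun i j => (r j <= r i)%N) (p ++ j :: s).
    by rewrite ps; apply: sort_sorted => a b; apply: leq_total.
  rewrite sorted_pairwise; last by move=> a b c ab bc; apply: leq_trans bc ab.
  rewrite pairwise_cat /= => /and3P[/allrelP p_ge _ /andP[/allP s_le _]].
  have uniq_js : uniq (p ++ j :: s) by rewrite (perm_uniq order_perm) enum_uniq.
  (* Indices after [j] have rank at most [r j], whereas those in [S j] have larger rank. *)
  have js : all (fun i => (i != j) && (i \notin S j)) s.
    apply/allP => i is_; apply/andP; split.
      apply: contraTneq is_ => ->; move: uniq_js; rewrite cat_uniq /=.
      by case/and3P => _ _ /andP[].
    by rewrite inE; apply/negP => /A_acyclic; rewrite ltnNge s_le.
  (* Indices before [j] have rank at least [r j], so their rows do not flip coordinate [j]: the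
     whole sign comes from the tail. *)
  have sign_tail : bott_sign m j =
      \big[addb/false]_(i <- s) (odd `|m i| && (j \in S i)).
    rewrite /bott_sign -big_enum -(perm_big _ order_perm) big_cat big_cons /=.
    rewrite (negPf (row_support_irr j)) andbF big1_seq // => i /= ip.
    have : (r j <= r i)%N by apply: p_ge; rewrite ?inE ?eqxx.
    rewrite leqNgt inE => /negP ri; apply/negbTE.
    by rewrite negb_and; apply/orP; right; apply/negP => /A_acyclic.
  rewrite /bott_lift_seq !big_cons -!/(bott_lift_seq s _) IHs.
  rewrite /twist_mul sign_tail.
  rewrite zpow4D ?cl_basis_expr4 // -!mulrA; congr (_ * _).
  by rewrite !mulrA bott_lift_seq_twist.
exact: (suffix_mul _ [::]).
Qed.

Lemma eq_bott_lift m m' : m =1 m' -> bott_lift m = bott_lift m'.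
Proof. by move=> mm'; apply: eq_bigr => i _; rewrite mm'. Qed.

Lemma bott_spin_structure : has_spin_structure Gamma.
Proof.
split=> [g|].
  elim=> [_ [i ->]||a b _ deta _ detb|a _ deta].
  - by rewrite bott_genE det_sign_mx -signr_odd (negPf (S_even i)).
  - exact: det1.
  - by rewrite /= det_mulmx deta detb mulr1.
  - by rewrite /= det_inv deta invr1.
(* On the group twice the translation is integral, so the floor recovers [m] exactly. *)
pose eps (g : affinity R n) := bott_lift (fun j => Num.floor (g.2 j 0 * 2)).
have epsE m : eps (bott_elt m) = bott_lift m.
  apply: eq_bott_lift => j.
  by rewrite mxE divfK ?pnatr_eq0 // intrKfloor.
exists eps; split=> [g /bott_group_elt[m ->]|g h|g /bott_group_elt[m ->]].
- by rewrite epsE; apply: Spin_bott_lift_seq.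
- move=> /bott_group_elt[m ->] /bott_group_elt[m' ->].
  by rewrite bott_elt_mul !epsE bott_liftM.
- by rewrite epsE spin_cover_bott_lift.
Qed.
End BottSpin.

(** * Reduction to pairs of rows *)

(** The entry [A i j] is the entry of [B] at [s i] and [s j], so [s] itself serves as the rank. *)
Lemma bott_matrix_acyclic (n : nat) (A : 'M['F_2]_n) : bott_matrix A ->
  exists r : 'I_n -> nat, forall i j, A i j != 0 -> (r i < r j)%N.
Proof.
case=> s [B [B_upper ->]]; exists (fun i => s i : nat) => i j.
have -> : invmx (perm_mx s) = perm_mx s^-1 :> 'M['F_2]_n.
  have VM : perm_mx s^-1 *m perm_mx s = 1%:M :> 'M['F_2]_n.
    by rewrite -perm_mxM mulVg perm_mx1.
  by rewrite -[RHS](mulmxK (unitmx_perm _ s)) VM mul1mx.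
rewrite -row_permE -col_permE !mxE ltnNge.
by apply: contraNN => /B_upper ->.
Qed.

Lemma row_support_two_rows (n : nat) (A : 'M['F_2]_n) (i j l : 'I_n) :
  row_support (two_rows A i j) l =
  if (l == i) || (l == j) then row_support A l else set0.
Proof.
by apply/setP => m; rewrite !inE mxE; case: ifP; rewrite !inE ?eqxx.
Qed.

Theorem theorem1p2 (R : realType) (n k : nat) (A : 'M['F_2]_n)
    (A_bott : bott_matrix A)
    (A_rows : #|[set i : 'I_n | row i A != 0]| = k)
    (k_even : ~~ odd k) :
  has_spin_structure (bott_group R A) <->
  (forall i j : 'I_n, (i < j)%N ->
     has_spin_structure (bott_group R (two_rows A i j))).
Proof.
have [r A_acyclic] := bott_matrix_acyclic A_bott.
have A2_acyclic i j l m : two_rows A i j l m != 0 -> (r l < r m)%N.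
  by rewrite mxE; case: ifP => [_ /A_acyclic//|]; rewrite eqxx.
split=> [spinA i j ij|spinA2].
  have evenA := spin_structure_even spinA.
  have relA := spin_structure_relation A_acyclic spinA.
  apply: (bott_spin_structure (A2_acyclic i j)) => [l|l m lm].
    by rewrite row_support_two_rows; case: ifP => // _; rewrite cards0.
  have e0 : cl_basis R (set0 : {set 'I_n}) = 1 by [].
  (* If row [m] is zeroed, its lift is 1 and both forms of the relation are trivial; if row [l] is,
     only commutation with 1 is asked. *)
  rewrite !row_support_two_rows; case: ifP => [_|_ _]; case: ifP => _.
  - exact: relA.
  - by rewrite in_set0 e0 /bott_relation mulr1 mul1r.
  - by rewrite e0 /bott_relation; case: ifP; rewrite !mulr1 !mul1r.
  - by rewrite in_set0.
have two_rowsC i j : two_rows A i j = two_rows A j i.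
  by apply/matrixP => l m; rewrite !mxE orbC.
have {}spinA2 i j : i != j ->
    has_spin_structure (bott_group R (two_rows A i j)).
  rewrite neq_ltn => /orP[/spinA2//|]; rewrite two_rowsC; exact: spinA2.
apply: (bott_spin_structure A_acyclic) => [i|i j ij].
  (* Any other index [j] gives a pair containing row [i]. If there is none, the support of row [i]
     is empty, since the diagonal of [A] is zero. *)
  have [j ij|i_only] := pickP (fun j => i != j).
    have := spin_structure_even (spinA2 i j ij) i.
    by rewrite row_support_two_rows eqxx.
  rewrite (_ : row_support A i = set0) ?cards0 //; apply/setP => j.
  have /negbFE/eqP <- := i_only j.
  by rewrite [RHS]inE (negPf (row_support_irr A_acyclic i)).
have := spin_structure_relation (A2_acyclic i j) (spinA2 i j ij) ij.
by rewrite !row_support_two_rows !eqxx orbT.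
Qed.
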